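(* Let $k$ be an algebraically closed field, and let $A$ be a just infinite $k$-algebra which does not satisfy a polynomial identity and whose center is $Z(A)=k$. Then $A$ is stably just infinite if and only if $A$ is centrally closed, i.e. the extended center $C(A)$ of $A$ equals $Z(A)$.
   Context: All rings are associative unital algebras over a field. A $k$-algebra $A$ is called just infinite if $\dim_k(A)=\infty$ and every nonzero two-sided ideal of $A$ has finite codimension in $A$; just infinite algebras are prime. A just infinite $k$-algebra $A$ is stably just infinite if $A\otimes_k K$ is just infinite over $K$ for every field extension $K/k$. For a prime ring $A$, the (right) Martindale ring of quotients $Q_r(A)$ consists of equivalence classes of pairs $(I,f)$ where $I$ is a nonzero two-sided ideal of $A$ and $f\colon I\to A$ is a right $A$-module homomorphism, two pairs $(I,f),(J,g)$ being equivalent if $f=g$ on $I\cap J$; addition is $(I,f)+(J,g)=(I\cap J,f+g)$ and multiplication $(I,f)(J,g)=(JI,f\circ g)$. The extended center $C(A)$ is the center of $Q_r(A)$; equivalently it consists of the classes of pairs $(I,f)$ with $f\colon I\to A$ an $(A,A)$-bimodule homomorphism. It is a field containing $Z(A)$, and $A$ is called centrally closed if $C(A)=Z(A)$. *)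

(* Defs.v *)
From HB Require Import structures.
From mathcomp Require Import all_boot all_order all_algebra.
Set Implicit Arguments. Unset Strict Implicit. Unset Printing Implicit Defensive.
Import GRing.Theory.
Local Open Scope ring_scope.

Section LinAlg.
Variable (R : fieldType) (V : lmodType R).

Definition in_span (s : seq V) (v : V) : Prop :=
  exists c : seq R, size c = size s /\ v = \sum_(i < size s) c`_i *: s`_i.

Definition lin_indep (s : seq V) : Prop :=
  forall c : seq R, size c = size s ->
    \sum_(i < size s) c`_i *: s`_i = 0 -> forall i, c`_i = 0.

Definition infinite_dim : Prop := ~ exists s : seq V, forall v, in_span s v.
End LinAlg.

Section Algebra.
Variable (k : fieldType) (A : algType k).

(* two-sided ideal of the ring A (automatically a k-subspace) *)
Definition two_sided_ideal (I : A -> Prop) : Prop :=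
  [/\ I 0, (forall x y, I x -> I y -> I (x + y)),
      (forall a x, I x -> I (a * x)) & (forall a x, I x -> I (x * a))].

Definition nonzero_set (I : A -> Prop) : Prop := exists x, I x /\ x != 0.

Definition finite_codim (I : A -> Prop) : Prop :=
  exists s : seq A, forall a, exists c : seq k,
    size c = size s /\ I (a - \sum_(i < size s) c`_i *: s`_i).

Definition just_infinite : Prop :=
  infinite_dim A /\
  forall I, two_sided_ideal I -> nonzero_set I -> finite_codim I.

(* A satisfies a polynomial identity: some nonzero element
   sum_{w in ws} c(w) w  (ws distinct words in x_0..x_{n-1}) of the free
   algebra k<x_0,...,x_{n-1}> vanishes at every n-tuple of elements of A *)
Definition satisfies_PI : Prop :=
  exists (n : nat) (ws : seq (seq 'I_n)) (c : seq 'I_n -> k),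
    [/\ uniq ws, has (fun w => c w != 0) ws &
        forall x : 'I_n -> A, \sum_(w <- ws) c w *: \prod_(i <- w) x i = 0].

Definition central (z : A) : Prop := forall a, z * a = a * z.

Definition center_is_scalars : Prop := forall z, central z -> exists c : k, z = c%:A.

(* (I, f) with I a nonzero ideal and f : I -> A an (A,A)-bimodule map:
   a representative of an element of the extended center C(A) *)
Definition bimod_hom_on (I : A -> Prop) (f : A -> A) : Prop :=
  [/\ (forall x y, I x -> I y -> f (x + y) = f x + f y),
      (forall a x, I x -> f (a * x) = a * f x) &
      (forall a x, I x -> f (x * a) = f x * a)].

(* C(A) = Z(A): every class [(I,f)] of C(A) is the class of some z in Z(A),
   i.e. of (A, x |-> z x), i.e. f agrees with left multiplication by z on I *)
Definition centrally_closed : Prop :=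
  forall (I : A -> Prop) (f : A -> A),
    two_sided_ideal I -> nonzero_set I -> bimod_hom_on I f ->
    exists z, central z /\ forall x, I x -> f x = z * x.
End Algebra.

(* (B, phi) is the scalar extension A (x)_k K, for K a field extension of k
   via iota: phi : A -> B is a ring map that is iota-semilinear, and the
   induced K-linear map A (x)_k K -> B is bijective: phi(A) spans B over K
   (surjectivity) and phi sends k-independent families to K-independent
   families (injectivity). *)
Definition scalar_extension (k K : fieldType) (iota : {rmorphism k -> K})
    (A : algType k) (B : algType K) (phi : A -> B) : Prop :=
  [/\ phi 1 = 1, (forall x y, phi (x + y) = phi x + phi y),
      (forall x y, phi (x * y) = phi x * phi y) &
      (forall (c : k) (a : A), phi (c *: a) = iota c *: phi a)] /\
  (forall b : B, exists s : seq A, in_span (map phi s) b) /\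
  (forall s : seq A, lin_indep s -> lin_indep (map phi s)).

Definition stably_just_infinite (k : fieldType) (A : algType k) : Prop :=
  just_infinite A /\
  forall (K : fieldType) (iota : {rmorphism k -> K}) (B : algType K) (phi : A -> B),
    scalar_extension iota phi -> just_infinite B.

(* Main.v *)
(* If A is centrally closed with center k, Martindale's shortest-length argument
   shows that every nonzero ideal of A (x) K meets A, hence has finite codimension.

   Conversely, suppose that a bimodule map f : I -> A is not multiplication by a
   scalar, and let J be the ideal (t - f) I(t) of A(t) = A (x) k(t).  If J had
   finite codimension, A would satisfy a standard identity modulo J, so J would
   contain some a != 0 of A, as A is not PI: q(t) a lies in (t - f) I[t] for some
   q != 0.  As k is algebraically closed, q splits; modulo (t - f) I[t] a factor
   t - c acts on I as f - c, which is injective because A is prime, so that q can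
   be made constant, which is absurd for degree reasons. *)

Require Import Defs.
From HB Require Import structures.
From mathcomp Require Import all_fingroup.
From mathcomp Require Import all_boot all_order all_algebra.
From mathcomp Require Import ring.
From Stdlib Require Import Classical ClassicalEpsilon.
Set Implicit Arguments. Unset Strict Implicit. Unset Printing Implicit Defensive.
Import GRing.Theory.
Local Open Scope ring_scope.
Local Open Scope quotient_scope.

(** * Linear algebra over a field *)

Section Span.
Variables (F : fieldType) (V : lmodType F).
Implicit Types (s t : seq V) (u v w : V).

(** Recursion on the list lets generators be peeled off one at a time, with no coefficient list
    whose length must be tracked. *)
Fixpoint lspan s v : Prop :=
  if s is x :: s' then exists c : F, lspan s' (v - c *: x) else v = 0.

Lemma lspanP s v :
  lspan s v <-> exists c : nat -> F, v = \sum_(i < size s) c i *: s`_i.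
Proof.
elim: s v => [|x s IH] v /=.
  split=> [->|[c ->]]; last by rewrite big_ord0.
  by exists (fun=> 0); rewrite big_ord0.
split=> [[a /IH[c Dv]]|[c ->]].
  exists (fun i => if i is j.+1 then c j else a).
  by rewrite big_ord_recl /= -[X in _ + X]Dv addrC subrK.
exists (c 0%N); apply/IH; exists (fun i => c i.+1).
by rewrite big_ord_recl /= addrAC subrr add0r.
Qed.

Lemma in_spanP s v : in_span s v <-> lspan s v.
Proof.
split=> [[c [_ ->]]|/lspanP[c ->]]; first by apply/lspanP; exists (nth 0 c).
exists (mkseq c (size s)); rewrite size_mkseq; split=> //.
by apply: eq_bigr => i _; rewrite nth_mkseq.
Qed.

Lemma lin_indepP s :
  lin_indep s <-> forall c : nat -> F,
    \sum_(i < size s) c i *: s`_i = 0 -> forall i, (i < size s)%N -> c i = 0.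
Proof.
split=> [hs c c0 i lti|hs c sc c0 i].
  have := hs (mkseq c (size s)); rewrite size_mkseq => /(_ erefl) h.
  rewrite -(nth_mkseq 0 c lti); apply: h; rewrite -[RHS]c0.
  by apply: eq_bigr => j _; rewrite nth_mkseq.
case: (ltnP i (size s)) => [|le_s]; first exact: (hs (nth 0 c)).
by rewrite nth_default ?sc.
Qed.

Lemma lspan0 s : lspan s 0.
Proof. by apply/lspanP; exists (fun=> 0); rewrite big1 // => i _; rewrite scale0r. Qed.

Lemma lspanD s u v : lspan s u -> lspan s v -> lspan s (u + v).
Proof.
move=> /lspanP[c ->] /lspanP[d ->]; apply/lspanP; exists (fun i => c i + d i).
by rewrite -big_split /=; apply: eq_bigr => i _; rewrite scalerDl.
Qed.

Lemma lspanZ s a v : lspan s v -> lspan s (a *: v).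
Proof.
move=> /lspanP[c ->]; apply/lspanP; exists (fun i => a * c i).
by rewrite scaler_sumr; apply: eq_bigr => i _; rewrite scalerA.
Qed.

Lemma lspanB s u v : lspan s u -> lspan s v -> lspan s (u - v).
Proof. by move=> su sv; rewrite -scaleN1r; apply/lspanD/lspanZ. Qed.

Lemma lspan_mem s x : x \in s -> lspan s x.
Proof.
elim: s => //= y s IH; rewrite inE => /predU1P[->|/IH sx].
  by exists 1; rewrite scale1r subrr; apply: lspan0.
by exists 0; rewrite scale0r subr0.
Qed.

Lemma lspan_closed (W : V -> Prop) s v :
  W 0 -> (forall x y, W x -> W y -> W (x + y)) ->
  (forall a x, W x -> W (a *: x)) -> (forall x, x \in s -> W x) ->
  lspan s v -> W v.
Proof.
move=> W0 WD WZ; elim: s v => [|x s IH] v Ws /= => [->//|[c sv]].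
rewrite -(subrK (c *: x) v); apply: WD; last exact/WZ/Ws/mem_head.
by apply: IH sv => y sy; apply: Ws; rewrite inE sy orbT.
Qed.

Lemma lspan_trans s t v : (forall x, x \in s -> lspan t x) -> lspan s v -> lspan t v.
Proof.
by apply: lspan_closed; [apply: lspan0 | apply: lspanD | apply: lspanZ].
Qed.

Lemma lspan_sub s t v : {subset s <= t} -> lspan s v -> lspan t v.
Proof. by move=> st; apply: lspan_trans => x /st/lspan_mem. Qed.

Lemma lspan_sum s n (u : 'I_n -> V) :
  (forall i, lspan s (u i)) -> lspan s (\sum_i u i).
Proof. by move=> su; apply: big_ind => //; [apply: lspan0 | apply: lspanD]. Qed.

Lemma lin_indep_nil : lin_indep ([::] : seq V).
Proof. by apply/lin_indepP. Qed.

Lemma lin_indep_cons x s :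
  lin_indep (x :: s) <-> ~ lspan s x /\ lin_indep s.
Proof.
split=> [/lin_indepP hxs|[sx /lin_indepP hs]].
  split=> [/lspanP[c Dx]|].
    have := hxs (fun i => if i is j.+1 then - c j else 1).
    rewrite big_ord_recl /= scale1r [X in X + _]Dx -big_split /=.
    rewrite big1 => [/(_ erefl 0%N erefl)/eqP|i _]; first by rewrite oner_eq0.
    by rewrite scaleNr subrr.
  apply/lin_indepP => c c0 i lti.
  apply: (hxs (fun i => if i is j.+1 then c j else 0) _ i.+1 lti).
  by rewrite big_ord_recl /= scale0r add0r.
apply/lin_indepP => c; rewrite big_ord_recl /= => c0.
have c00 : c 0%N = 0.
  apply/eqP/negP => /negP nz; apply: sx; apply/lspanP.
  exists (fun i => - (c 0%N)^-1 * c i.+1).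
  rewrite -[LHS](scalerK nz) (canRL (addrK _) c0) sub0r scalerN -scaleNr.
  by rewrite scaler_sumr; apply: eq_bigr => i _; rewrite scalerA.
move: c0; rewrite c00 scale0r add0r => c0 [//|i]; rewrite ltnS.
exact: (hs (fun i => c i.+1)).
Qed.

(** Serves to re-expand finitely many vectors, of [A] or of [K] over [k], in independent ones. The
    list is built by adding a vector only when it lies outside the span so far. *)
Lemma lin_indep_extract s :
  exists2 e, lin_indep e & forall x, x \in s -> lspan e x.
Proof.
elim: s => [|x s [e fe se]]; first by exists [::]; first exact: lin_indep_nil.
case: (classic (lspan e x)) => ex.
  by exists e => // y; rewrite inE => /predU1P[->|/se].
exists (x :: e) => [|y]; first exact/lin_indep_cons.
rewrite inE => /predU1P[->|/se ey]; first by apply/lspan_mem/mem_head.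
by exists 0; rewrite scale0r subr0.
Qed.

Lemma infinite_dimP : infinite_dim V <-> forall s, ~ forall v, lspan s v.
Proof.
split=> [nfd s sT|nfd [s sT]].
  by apply: nfd; exists s => v; apply/in_spanP.
by apply: (nfd s) => v; apply/in_spanP.
Qed.

(** * Relative finite codimension of subspaces *)

Definition subspace (W : V -> Prop) :=
  [/\ W 0, forall x y, W x -> W y -> W (x + y) & forall a x, W x -> W (a *: x)].

(** In other words [U] is contained in [W + span s]; neither [W] nor [s] has to lie inside [U]. *)
Definition covers (W : V -> Prop) s (U : V -> Prop) :=
  forall v, U v -> exists2 w, lspan s w & W (v - w).

Lemma subspaceB W x y : subspace W -> W x -> W y -> W (x - y).
Proof. by case=> _ WD WZ Wx Wy; rewrite -scaleN1r; apply/WD/WZ. Qed.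

Lemma covers_capl s (W U : V -> Prop) :
  subspace W -> subspace U -> covers W s U ->
  exists t, covers (fun v => W v /\ U v) t U.
Proof.
elim: s W U => [|x s IH] W U sW sU cov.
  exists [::] => v Uv; have [w /= -> Wv] := cov v Uv.
  by exists 0 => //=; rewrite subr0 in Wv *.
pose W' v := exists2 w, lspan s w & W (v - w).
case: (classic (forall v, U v -> W' v)) => [/(IH _ _ sW sU)//|].
move=> /not_all_ex_not[u0 nh].
have [Uu0 nW'u0] : U u0 /\ ~ W' u0.
  by split; [apply: NNPP => nU; apply: nh | move=> h; apply: nh].
have [W0 WD WZ] := sW; have [U0 UD UZ] := sU.
have [w0 /= [c sw0] Ww0] := cov u0 Uu0.
(* A zero coefficient at [x] would put [u0] in [W']. *)
have c_neq0 : c != 0.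
  apply: contra_not_neq nW'u0 => c0; exists w0 => //.
  by rewrite c0 scale0r subr0 in sw0.
pose U' v := U v /\ W' v.
have sW' : subspace W'.
  split=> [|v v' [w sw Ww] [w' sw' Ww']|a v [w sw Ww]].
  - by exists 0; [apply: lspan0 | rewrite subr0].
  - by exists (w + w'); [apply: lspanD | rewrite opprD addrACA; apply: WD].
  - by exists (a *: w); [apply: lspanZ | rewrite -scalerBr; apply: WZ].
have sU' : subspace U'.
  have [? W'D W'Z] := sW'.
  split=> [//|v v' [? ?] [? ?]|a v [? ?]].
    by split; [apply: UD | apply: W'D].
  by split; [apply: UZ | apply: W'Z].
have [t ct] : exists t, covers (fun v => W v /\ U' v) t U'.
  by apply: IH => // v [_ []] w; exists w.
exists (u0 :: t) => v Uv.
have [w /= [d sw] Ww] := cov v Uv.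
(* The factor [d / c] is chosen to cancel the [x]-coefficient [d] of [v] against the coefficient [c]
   of [u0]. *)
have U'v : U' (v - (d / c) *: u0).
  split; first exact/(subspaceB sU)/UZ.
  exists (w - (d / c) *: w0).
    rewrite -[w](subrK (d *: x)) -[w0](subrK (c *: x)) scalerDr scalerA.
    by rewrite divfK // opprD addrACA subrr addr0; apply/lspanB/lspanZ.
  have -> : v - d / c *: u0 - (w - d / c *: w0) = v - w - d / c *: (u0 - w0).
    by rewrite scalerBr !opprB addrACA [- _ - w]addrC -addrACA.
  exact/(subspaceB sW)/WZ.
have [w' sw' [Ww' [Uw' _]]] := ct _ U'v.
exists (w' + (d / c) *: u0); last by rewrite opprD addrA addrAC.
by exists (d / c); rewrite addrK.
Qed.

End Span.

(** * Just infinite algebras *)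

Section JustInfinite.
Variables (k : fieldType) (A : algType k).
Implicit Types (I J : A -> Prop) (a b x y z : A).

Lemma finite_codimP I :
  finite_codim I <-> exists s, covers I s (fun=> True).
Proof.
split=> [[s cov]|[s cov]]; exists s => a.
  move=> _; have [c [sc Ic]] := cov a.
  by exists (\sum_(i < size s) c`_i *: s`_i) => //; apply/lspanP; exists (nth 0 c).
by have [//|w /in_spanP[c [sc ->]] Iw] := cov a; exists c.
Qed.

Lemma ideal_subspace I : two_sided_ideal I -> subspace I.
Proof. by case=> I0 ID Il _; split=> // c x Ix; rewrite -mulr_algl; apply: Il. Qed.

Hypothesis jiA : just_infinite A.

(* If a A b = 0 then, with I = l.ann(A b) and J = r.ann(A I), I and J have
   finite codimension, so they share some x != 0; as I x = x J = 0, the ideal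
   A x A is finite dimensional, and of finite codimension. *)
Lemma just_infinite_prime a b : (forall r, a * r * b = 0) -> a = 0 \/ b = 0.
Proof.
have [infA fcA] := jiA => aAb.
apply: NNPP => /not_or_and[/eqP a0 /eqP b0].
pose I x := forall r, x * r * b = 0.
pose J y := forall x, I x -> forall r, x * r * y = 0.
have idI : two_sided_ideal I.
  split=> [r|x y Ix Iy r|c x Ix r|c x Ix r].
  - by rewrite !mul0r.
  - by rewrite !mulrDl Ix Iy addr0.
  - by rewrite -!mulrA mulrA -mulrA [x * _]mulrA Ix mulr0.
  - by rewrite -(mulrA x) Ix.
have idJ : two_sided_ideal J.
  split=> [x _ r|y z Jy Jz x Ix r|c y Jy x Ix r|c y Jy x Ix r].
  - by rewrite mulr0.
  - by rewrite mulrDr Jy ?Jz ?addr0.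
  - by rewrite mulrA -(mulrA x) Jy.
  - by rewrite mulrA Jy ?mul0r.
have nzI : nonzero_set I by exists a.
have nzJ : nonzero_set J by exists b; split=> // x Ix r; apply: Ix.
have /finite_codimP[s cI] := fcA I idI nzI.
have /finite_codimP[t cJ] := fcA J idJ nzJ.
(* If [I] and [J] met only in 0, [covers_capl] would make [J] finite dimensional, and then [A],
   spanned by [J] and [t], as well. *)
have [x [[Ix Jx] x0]] : exists x, (I x /\ J x) /\ x <> 0.
  apply: NNPP => noIJ.
  have covIJ : covers I s J by move=> v _; apply: cI.
  have [u cu] := covers_capl (ideal_subspace idI) (ideal_subspace idJ) covIJ.
  have/infinite_dimP := infA; move/(_ (u ++ t)); apply=> v.
  have [//|w tw Jw] := cJ v.
  have [w' uw' Iw'] := cu _ Jw.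
  have /subr0_eq Dw' : v - w - w' = 0.
    by apply: NNPP => nz; apply: noIJ; exists (v - w - w').
  rewrite -(subrK w v) Dw'; apply: lspanD.
    by apply: (lspan_sub _ uw') => z; rewrite mem_cat => ->.
  by apply: (lspan_sub _ tw) => z; rewrite mem_cat orbC => ->.
have Ix0 i : I i -> i * x = 0 by move=> Ii; rewrite -[i]mulr1 Jx.
have xJ0 j : J j -> x * j = 0 by move=> Jj; rewrite -[x]mulr1 Jj.
(* Since [I x = 0 = x J], reducing [y] modulo [I] and [z] modulo [J] leaves [y x z] unchanged, so
   these finitely many products span [A x A]. *)
pose p := [seq y * x * z | y <- s, z <- t].
have sp y z : lspan p (y * x * z).
  have [//|v sv Iv] := cI y; have [//|w tw Jw] := cJ z.
  have -> : y * x * z = v * x * w.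
    rewrite -(subrK v y) -{1}(subrK w z) mulrDl Ix0 // add0r.
    by rewrite mulrDr -mulrA xJ0 // mulr0 add0r.
  elim/lspan_closed: sv => [|u u'|c u|u su].
  - by rewrite !mul0r; apply: lspan0.
  - by rewrite !mulrDl; apply: lspanD.
  - by rewrite -!scalerAl; apply: lspanZ.
  elim/lspan_closed: tw => [|u1 u1'|c u1|u1 tu1].
  - by rewrite mulr0; apply: lspan0.
  - by rewrite mulrDr; apply: lspanD.
  - by rewrite -scalerAr; apply: lspanZ.
  exact/lspan_mem/allpairs_f.
have idM : two_sided_ideal (lspan p).
  split=> [||c m pm|c m pm]; [exact: lspan0 | by move=> *; apply: lspanD | |].
  - elim/lspan_closed: pm => [|u u'|d u|u /allpairsP[[y z] [_ _ ->]]].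
    + by rewrite mulr0; apply: lspan0.
    + by rewrite mulrDr; apply: lspanD.
    + by rewrite -scalerAr; apply: lspanZ.
    + by rewrite !mulrA; apply: sp.
  - elim/lspan_closed: pm => [|u u'|d u|u /allpairsP[[y z] [_ _ ->]]].
    + by rewrite mul0r; apply: lspan0.
    + by rewrite mulrDl; apply: lspanD.
    + by rewrite -scalerAl; apply: lspanZ.
    + by rewrite -mulrA; apply: sp.
have nzM : nonzero_set (lspan p).
  by exists x; split; [have := sp 1 1; rewrite mul1r mulr1 | apply/eqP].
have /finite_codimP[u cu] := fcA _ idM nzM.
have/infinite_dimP := infA; move/(_ (p ++ u)); apply=> v.
have [//|w uw pw] := cu v; rewrite -(subrK w v); apply: lspanD.
  by apply: (lspan_sub _ pw) => z; rewrite mem_cat => ->.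
by apply: (lspan_sub _ uw) => z; rewrite mem_cat orbC => ->.
Qed.

(* In a centrally closed prime ring, a r b = b r a for all r makes b a
   multiple of a: x |-> y, where y r a = x r b for all r, is a bimodule map. *)
Lemma centrally_closed_proportional a b :
  center_is_scalars A -> centrally_closed A ->
  a != 0 -> (forall r, b * r * a = a * r * b) -> exists c : k, b = c *: a.
Proof.
move=> cenA ccA a0 ab.
(* [G] is the graph of multiplication by the formal quotient [b / a]; primeness and [a != 0] make it
   single-valued. *)
pose G x y := forall r, y * r * a = x * r * b.
have Ginj x y y' : G x y -> G x y' -> y = y'.
  move=> Gy Gy'; apply: subr0_eq.
  have [] // := @just_infinite_prime (y - y') a => [r|/eqP aE0].
    by rewrite !mulrBl Gy Gy' subrr.
  by rewrite aE0 in a0.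
have GD x y x' y' : G x y -> G x' y' -> G (x + x') (y + y').
  by move=> Gx Gx' r; rewrite !mulrDl Gx Gx'.
have Gl c x y : G x y -> G (c * x) (c * y).
  by move=> Gx r; rewrite -!mulrA [y * _]mulrA Gx !mulrA.
have Gr c x y : G x y -> G (x * c) (y * c).
  by move=> Gx r; rewrite -(mulrA y) Gx !mulrA.
pose I x := exists y, G x y.
(* Off [I] the chosen value is arbitrary, which is harmless because [bimod_hom_on] constrains [f] on
   [I] only. *)
pose f x := epsilon (inhabits 0) (G x).
have fP x : I x -> G x (f x) by move=> Ix; apply: epsilon_spec.
have fE x y : G x y -> f x = y.
  by move=> Gxy; apply: Ginj (Gxy); apply: fP; exists y.
have Ga : G a b by move=> r; rewrite ab.
have idI : two_sided_ideal I.
  split=> [|x y [x' ?] [y' ?]|c x [x' ?]|c x [x' ?]].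
  - by exists 0 => r; rewrite !mul0r.
  - by exists (x' + y'); apply: GD.
  - by exists (c * x'); apply: Gl.
  - by exists (x' * c); apply: Gr.
have nzI : nonzero_set I by exists a; split=> //; exists b.
have fI : bimod_hom_on I f.
  split=> [x y Ix Iy|c x Ix|c x Ix]; apply: fE.
  - by apply: GD; apply: fP.
  - by apply: Gl; apply: fP.
  - by apply: Gr; apply: fP.
have [z [/cenA[c ->] fz]] := ccA I f idI nzI fI.
by exists c; rewrite -(fE _ _ Ga) fz ?mulr_algl //; exists b.
Qed.

End JustInfinite.

(** * Scalar extensions of centrally closed algebras *)

Section RestrictScalars.
Variables (k K : fieldType) (iota : {rmorphism k -> K}).

(** This is [K] as a [k]-vector space. The vacuous [let] keeps [iota] in the type, so that the
    module structure found for it can depend on [iota]. *)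
Definition restricted : Type := let _ := iota in K.
HB.instance Definition _ := GRing.Zmodule.copy restricted K.

Definition restricted_scale (c : k) (x : restricted) : restricted :=
  iota c * (x : K).

Fact restricted_scaleA a b x :
  restricted_scale a (restricted_scale b x) = restricted_scale (a * b) x.
Proof. by rewrite /restricted_scale rmorphM mulrA. Qed.
Fact restricted_scale1 : left_id 1 restricted_scale.
Proof. by move=> x; rewrite /restricted_scale rmorph1 mul1r. Qed.
Fact restricted_scaleDr : right_distributive restricted_scale +%R.
Proof. by move=> a x y; apply: mulrDr. Qed.
Fact restricted_scaleDl x : {morph restricted_scale^~ x : a b / a + b}.
Proof. by move=> a b; rewrite /restricted_scale rmorphD mulrDl. Qed.

HB.instance Definition _ := GRing.Zmodule_isLmodule.Build k restricted
  restricted_scaleA restricted_scale1 restricted_scaleDr restricted_scaleDl.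

Lemma restrictedZE (c : k) (x : restricted) : c *: x = iota c * (x : K).
Proof. by []. Qed.

End RestrictScalars.
Arguments restricted {k K} iota.

Section ScalarExtension.
Variables (k K : fieldType) (iota : {rmorphism k -> K}).
Variables (A : algType k) (B : algType K) (phi : A -> B).
Hypothesis phiP : scalar_extension iota phi.

Let phi1 : phi 1 = 1. Proof. by case: phiP => [[]]. Qed.
Let phiD x y : phi (x + y) = phi x + phi y. Proof. by case: phiP => [[]]. Qed.
Let phiM x y : phi (x * y) = phi x * phi y. Proof. by case: phiP => [[]]. Qed.
Let phiZ c a : phi (c *: a) = iota c *: phi a. Proof. by case: phiP => [[]]. Qed.

Lemma scalar_extD x y : phi (x + y) = phi x + phi y.
Proof. exact: phiD. Qed.

Lemma scalar_ext0 : phi 0 = 0.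
Proof. by apply: (@addrI _ (phi 0)); rewrite -phiD !addr0. Qed.

Lemma scalar_extB x y : phi (x - y) = phi x - phi y.
Proof. by apply: (addIr (phi y)); rewrite -phiD !subrK. Qed.

Lemma scalar_ext_sum n (F : 'I_n -> A) :
  phi (\sum_i F i) = \sum_i phi (F i).
Proof. exact: (big_morph phi phiD scalar_ext0). Qed.

Lemma scalar_ext_prod n (F : 'I_n -> A) :
  phi (\prod_i F i) = \prod_i phi (F i).
Proof. exact: (big_morph phi phiM phi1). Qed.

Lemma scalar_ext_lspan b : exists s, lspan (map phi s) b.
Proof. by have [_ [/(_ b)[s /in_spanP sb] _]] := phiP; exists s. Qed.

Lemma scalar_ext_indep s : lin_indep s -> lin_indep (map phi s).
Proof. by have [_ [_]] := phiP; apply. Qed.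

Lemma lspan_scalar_ext s a : lspan s a -> lspan (map phi s) (phi a).
Proof.
elim/lspan_closed => [|x y|c x|x sx].
- by rewrite scalar_ext0; apply: lspan0.
- by rewrite phiD; apply: lspanD.
- by rewrite phiZ; apply: lspanZ.
- exact/lspan_mem/map_f.
Qed.

(** A finite spanning list of [B] lies in the [K]-span of [phi e] for some independent [e] in [A].
    For [a] outside the span of [e], the family [phi a], [phi e] would be independent, a
    contradiction. *)
Lemma scalar_ext_infinite_dim : infinite_dim A -> infinite_dim B.
Proof.
move=> /infinite_dimP infA; apply/infinite_dimP => s sT.
have [t ts] : exists t, forall b, b \in s -> lspan (map phi t) b.
  elim: (s) => [|b s' [t ts]]; first by exists [::].
  have [t' t'b] := scalar_ext_lspan b.
  exists (t' ++ t) => b'; rewrite inE map_cat => /predU1P[->|/ts].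
    by apply: (lspan_sub _ t'b) => z; rewrite mem_cat => ->.
  by apply: lspan_sub => z; rewrite mem_cat orbC => ->.
have [e fe et] := lin_indep_extract t.
apply: (infA e) => a; apply: NNPP => ea.
have /scalar_ext_indep/lin_indep_cons[[]] : lin_indep (a :: e).
  exact/lin_indep_cons.
apply: lspan_trans (sT (phi a)) => b /ts; apply: lspan_trans => _ /mapP[x tx ->].
exact/lspan_scalar_ext/et.
Qed.

(** Expand the [b i] in an independent list [e]. Independence of [phi e] over [K] isolates, for each
    basis vector, a [k]-linear relation between the [mu_i], which must be trivial. *)
Lemma scalar_ext_free n (mu : seq (restricted iota)) (b : nat -> A) :
  lin_indep mu -> size mu = n ->
  \sum_(i < n) (mu`_i : K) *: phi (b i) = 0 -> forall i, (i < n)%N -> b i = 0.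
Proof.
move=> /lin_indepP fmu sz_mu sum0.
have [e fe eb] := lin_indep_extract (mkseq b n).
have /fin_all_exists[m Db] : forall i : 'I_n, exists mi : nat -> k,
    b i = \sum_(j < size e) mi j *: e`_j.
  move=> i; apply/lspanP/eb/mapP.
  by exists (val i) => //; rewrite mem_iota add0n ltn_ord.
have /lin_indepP fphie := scalar_ext_indep fe.
have m0 (i : 'I_n) j : (j < size e)%N -> m i j = 0.
  move=> ltj.
  (* [c] extends the ordinal-indexed column [m _ j] to all naturals by 0, the form required by
     [lin_indepP]. *)
  pose c i := if insub i is Some i' then m i' j else 0.
  have -> : m i j = c i by rewrite /c valK.
  apply: (fmu c); last by rewrite sz_mu.
  pose d j := \sum_(i < n) (mu`_i : K) * iota (m i j).
  have <- : d j = \sum_(i < size mu) c i *: mu`_i.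
    rewrite sz_mu; apply: eq_bigr => i' _.
    by rewrite restrictedZE mulrC /c valK.
  apply: fphie; last by rewrite size_map.
  rewrite -[RHS]sum0 size_map; under eq_bigr do rewrite scaler_suml.
  rewrite exchange_big; apply: eq_bigr => i' _ /=.
  rewrite Db scalar_ext_sum scaler_sumr; apply: eq_bigr => j' _.
  by rewrite phiZ scalerA (nth_map 0).
move=> i lti; rewrite (Db (Ordinal lti)) big1 // => j _.
by rewrite m0 ?scale0r.
Qed.

(** Start from any expression of [u] over [phi A], expand its coefficients in a [k]-independent list
    of [K], and exchange the two sums. *)
Lemma scalar_ext_free_repr u :
  exists (mu : seq (restricted iota)) (a : nat -> A), lin_indep mu /\
    u = \sum_(i < size mu) (mu`_i : K) *: phi (a i).
Proof.
have [s /lspanP[c ->]] := scalar_ext_lspan u.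
rewrite size_map; set n := size s.
have [e fe ec] := lin_indep_extract (mkseq c n : seq (restricted iota)).
have /fin_all_exists[m Dc] : forall i : 'I_n, exists mi : nat -> k,
    c i = \sum_(j < size e) mi j *: e`_j :> restricted iota.
  move=> i; apply/lspanP/ec/mapP.
  by exists (val i) => //; rewrite mem_iota add0n ltn_ord.
exists e, (fun j => \sum_(i < n) m i j *: s`_i); split=> //.
under [RHS]eq_bigr do rewrite scalar_ext_sum scaler_sumr.
rewrite exchange_big; apply: eq_bigr => i _ /=.
rewrite Dc (nth_map 0) // scaler_suml; apply: eq_bigr => j _.
by rewrite phiZ scalerA restrictedZE mulrC.
Qed.

Section Ideals.
Hypothesis jiA : just_infinite A.
Hypothesis cenA : center_is_scalars A.
Hypothesis ccA : centrally_closed A.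
Variable J : B -> Prop.
Hypothesis idJ : two_sided_ideal J.

(* Martindale's shortest-length argument: u phi(r a) - phi(a r) u, with a the
   first coefficient of u, is a shorter element of J. *)
Lemma scalar_ext_ideal_meets (mu : seq (restricted iota)) (a : nat -> A) u :
  lin_indep mu -> u = \sum_(i < size mu) (mu`_i : K) *: phi (a i) ->
  J u -> u != 0 -> exists2 x, x != 0 & J (phi x).
Proof.
have [J0 JD Jl Jr] := idJ.
have [_ _ JZ] := ideal_subspace idJ.
elim: mu a u => [|m mu IH] a u; first by rewrite big_ord0 => _ ->; rewrite eqxx.
move=> fmmu Du Ju u0; have [_ fmu] := (lin_indep_cons _ _).1 fmmu.
move: Du; rewrite big_ord_recl /= => Du.
have [a00|a0] := eqVneq (a 0%N) 0.
  apply: (IH (a \o S) u) => //.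
  by rewrite Du a00 scalar_ext0 scaler0 add0r.
pose v r := u * phi (r * a 0%N) - phi (a 0%N * r) * u.
have Jv r : J (v r) by rewrite /v -mulN1r mulrA; apply: JD; [apply: Jr | apply: Jl].
have Dv r : v r = \sum_(i < size mu)
    (mu`_i : K) *: phi (a i.+1 * r * a 0%N - a 0%N * r * a i.+1).
  rewrite /v Du mulrDl mulrDr -scalerAl -scalerAr -!phiM !mulrA.
  rewrite opprD addrACA subrr add0r mulr_suml mulr_sumr -sumrB.
  apply: eq_bigr => i _.
  by rewrite scalar_extB scalerBr -scalerAl -scalerAr -!phiM mulrA.
case: (classic (exists r, v r != 0)) => [[r vr0]|nv].
  exact: (IH (fun i => a i.+1 * r * a 0%N - a 0%N * r * a i.+1) (v r)).
(* When every [v r] vanishes, freeness of [mu] yields one commutation relation per coefficient, and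
   these force each [a i.+1] to be a multiple of [a 0]. *)
have comm i r : (i < size mu)%N -> a i.+1 * r * a 0%N = a 0%N * r * a i.+1.
  move=> lti; apply: subr0_eq.
  apply: (scalar_ext_free (n := size mu) (mu := mu)
    (b := fun i => a i.+1 * r * a 0%N - a 0%N * r * a i.+1)) => //.
  by rewrite -Dv; apply/eqP; apply: contra_notT nv => ?; exists r.
have /fin_all_exists[c Da] : forall i : 'I_(size mu), exists c : k,
    a i.+1 = c *: a 0%N.
  by move=> i; apply: centrally_closed_proportional => // r; apply: comm.
(* Now [u] collapses to [lam *: phi (a 0)]; [lam] is nonzero because [u] is, so dividing by it keeps
   [phi (a 0)] in [J]. *)
pose lam : K := m + \sum_(i < size mu) (mu`_i : K) * iota (c i).
have {}Du : u = lam *: phi (a 0%N).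
  rewrite Du scalerDl scaler_suml; congr (_ + _); apply: eq_bigr => i _.
  by rewrite Da phiZ scalerA.
have lam0 : lam != 0 by apply: contraNneq u0 => lam0; rewrite Du lam0 scale0r.
by exists (a 0%N); rewrite // -[phi _](scalerK lam0) -Du; apply: JZ.
Qed.

(** The contraction of [J] to [A] is a nonzero ideal, so a finite list [s] covers [A] modulo it. As
    [phi A] spans [B] over [K], the list [phi s] covers [B] modulo [J]. *)
Lemma scalar_ext_ideal_finite_codim : nonzero_set J -> finite_codim J.
Proof.
have [J0 JD Jl Jr] := idJ.
have [_ _ JZ] := ideal_subspace idJ.
move=> [u [Ju u0]]; have [mu [a [fmu Du]]] := scalar_ext_free_repr u.
have [x x0 Jx] := scalar_ext_ideal_meets fmu Du Ju u0.
have idI : two_sided_ideal (J \o phi).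
  split=> [|y z Jy Jz|c y Jy|c y Jy] /=.
  - by rewrite scalar_ext0.
  - by rewrite phiD; apply: JD.
  - by rewrite phiM; apply: Jl.
  - by rewrite phiM; apply: Jr.
have /finite_codimP[s cs] := jiA.2 _ idI (ex_intro _ x (conj Jx x0)).
apply/finite_codimP; exists (map phi s) => b _.
have [t] := scalar_ext_lspan b.
elim/lspan_closed => [|y z [v sv Jv] [w sw Jw]|c y [v sv Jv]|_ /mapP[y ty ->]].
- by exists 0; [apply: lspan0 | rewrite subr0].
- by exists (v + w); [apply: lspanD | rewrite opprD addrACA; apply: JD].
- by exists (c *: v); [apply: lspanZ | rewrite -scalerBr; apply: JZ].
- have [//|w sw Jw] := cs y.
  by exists (phi w); [apply: lspan_scalar_ext | rewrite -scalar_extB].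
Qed.

End Ideals.
End ScalarExtension.

Lemma centrally_closed_stably_just_infinite (k : fieldType) (A : algType k) :
  just_infinite A -> center_is_scalars A -> centrally_closed A ->
  stably_just_infinite A.
Proof.
move=> jiA cenA ccA; split=> // K iota B phi phiP; split.
  by apply: (scalar_ext_infinite_dim phiP); case: jiA.
by move=> J idJ; apply: (scalar_ext_ideal_finite_codim phiP).
Qed.

(** * Standard identities *)

Lemma satisfies_standard_identity (k : fieldType) (A : algType k) n :
  (forall x : 'I_n -> A, \sum_(s : 'S_n) (-1) ^+ s *: \prod_i x (s i) = 0 :> A) ->
  satisfies_PI A.
Proof.
move=> std0; pose word (s : 'S_n) := [seq s i | i <- index_enum 'I_n].
(* Coefficients must be a function of the word. Distinct permutations have distinct words, so at
   [word s] this sum has the single term given by the sign of [s]. *)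
pose c (w : seq 'I_n) : k := \sum_(s | word s == w) (-1) ^+ s.
have word_inj : injective word.
  by move=> s t /eq_in_map est; apply/perm.permP => i; rewrite est ?mem_index_enum.
have cE s : c (word s) = (-1) ^+ s.
  by rewrite /c (big_pred1 s) // => t; apply: (inj_eq word_inj).
exists n, [seq word s | s <- enum {: 'S_n}], c; split=> [||x].
- by rewrite map_inj_uniq ?enum_uniq.
- apply/hasP; exists (word 1%g); first by rewrite map_f ?mem_enum.
  by rewrite cE signr_eq0.
rewrite -[RHS](std0 x) big_map big_enum; apply: eq_bigr => s _ /=.
by rewrite cE big_map.
Qed.

(* If more vectors v_i than generators t_j are used, each term of the expansion
   of the standard polynomial is a determinant with two equal rows. *)
Lemma standard_identity_lspan (K : fieldType) (B : algType K) (t : seq B) n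
    (v : 'I_n -> B) :
  (size t < n)%N -> (forall i, lspan t (v i)) ->
  \sum_(s : 'S_n) (-1) ^+ s *: \prod_i v (s i) = 0 :> B.
Proof.
move=> lt_t_n tv.
have /fin_all_exists[c Dv] : forall i : 'I_n, exists ci : nat -> K,
    v i = \sum_(j < size t) ci j *: t`_j.
  by move=> i; apply/lspanP.
(* [f] selects a generator for each position; for fixed [f], the signed sum of the coefficients over
   all permutations is a determinant. *)
transitivity (\sum_(f : {ffun 'I_n -> 'I_(size t)})
    \det (\matrix_(i, j) c j (f i)) *: \prod_i t`_(f i)); last first.
  apply: big1 => f _.
  have /injectivePn[i1 [i2 ne_i eq_f]] : ~~ injectiveb f.
    by apply/injectiveP => /leq_card; rewrite !card_ord leqNgt lt_t_n.
  rewrite (determinant_alternate ne_i) ?scale0r // => j.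
  by rewrite !mxE eq_f.
under [RHS]eq_bigr do rewrite scaler_suml.
rewrite exchange_big; apply: eq_bigr => s _ /=.
under eq_bigr do rewrite Dv.
rewrite bigA_distr_bigA scaler_sumr; apply: eq_bigr => f _ /=.
rewrite scaler_prod scalerA; congr (_ * _ *: _).
by apply: eq_bigr => i _; rewrite mxE.
Qed.

(** * From finite codimension to a polynomial identity *)

Section FiniteQuotient.
Variables (k K : fieldType) (iota : {rmorphism k -> K}).
Variables (A : algType k) (B : algType K) (phi : A -> B).
Hypothesis phiP : scalar_extension iota phi.

(** Modulo [J], every [phi (x i)] is a combination of the vectors of [t], so the standard polynomial
    of degree [size t + 1] takes values in [J] on [phi A]. Injectivity modulo [J] brings the
    identity back to [A]. *)
Lemma satisfies_PI_of_finite_codim (J : B -> Prop) :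
  two_sided_ideal J -> finite_codim J -> (forall a, J (phi a) -> a = 0) ->
  satisfies_PI A.
Proof.
move=> idJ /finite_codimP[t ct] injJ; have [J0 JD Jl Jr] := idJ.
have [_ _ JZ] := ideal_subspace idJ.
have [[_ _ _ phiZ] _] := phiP.
apply: (@satisfies_standard_identity _ _ (size t).+1) => x; apply: injJ.
have /fin_all_exists[v xv] : forall i, exists v, lspan t v /\ J (phi (x i) - v).
  by move=> i; have [//|v tv Jv] := ct (phi (x i)); exists v.
rewrite (big_morph phi (scalar_extD phiP) (scalar_ext0 phiP)) -[X in J X]subr0.
have std0 : \sum_(s : 'S_(size t).+1) (-1) ^+ s *: \prod_i v (s i) = 0 :> B.
  by apply: (@standard_identity_lspan _ _ t) => // i; case: (xv i).
rewrite -[X in _ - X]std0 -sumrB; apply: big_ind => // s _.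
rewrite phiZ rmorphXn rmorphN1 -scalerBr; apply: JZ.
rewrite (scalar_ext_prod phiP).
(* Congruence modulo the two-sided ideal [J] is compatible with products. *)
apply: (big_ind2 (fun x y => J (x - y))) => [|x1 x2 y1 y2 J1 J2|i _].
- by rewrite subrr.
- have -> : x1 * y1 - x2 * y2 = (x1 - x2) * y1 + x2 * (y1 - y2).
    by rewrite mulrBl mulrBr addrA subrK.
  by apply: JD; [apply: Jr | apply: Jl].
- by case: (xv (s i)).
Qed.

End FiniteQuotient.

(** * Central localization and A(t) *)

Lemma tofrac_reprP (D : idomainType) (c : {fraction D}) :
  exists n d : D, d != 0 /\ c * tofrac d = tofrac n.
Proof.
elim/quotW: c => x; exists \n_x, \d_x; split; first exact: denom_ratioP.
unlock FracField.tofrac; rewrite -[LHS]FracField.pi_mul; apply/eqmodP.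
rewrite /= FracField.equivfE /FracField.mulf.
by rewrite !numden_Ratio ?mulf_neq0 ?oner_neq0 ?denom_ratioP // !mulr1 mulrC.
Qed.

Section Localization.
Variables (D : idomainType) (R : algType D).
Hypothesis torsion_free : forall (q : D) (p : R), q != 0 -> q *: p = 0 -> p = 0.

Definition denom := {q : D | q != 0}.
Definition denomM (q r : denom) : denom :=
  Sub (val q * val r) (mulf_neq0 (valP q) (valP r)).
Definition denom1 : denom := Sub 1 (oner_neq0 D).
Definition denomX (d : D) (d0 : d != 0) : denom := Sub d d0.

Definition loc_eq (x y : R * denom) := val y.2 *: x.1 == val x.2 *: y.1.

Fact loc_eq_refl : reflexive loc_eq. Proof. by move=> x; apply: eqxx. Qed.
Fact loc_eq_sym : symmetric loc_eq. Proof. by move=> x y; apply: eq_sym. Qed.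
Fact loc_eq_trans : transitive loc_eq.
Proof.
move=> [p q] [p1 q1] [p2 q2] /eqP /= E1 /eqP /= E2; apply/eqP => /=.
(* [transitive] quantifies the middle element first, so [q] is the middle denominator, to be
   cancelled by torsion-freeness. *)
apply: subr0_eq; apply: (torsion_free (valP q)).
rewrite scalerBr scalerA mulrC -scalerA E1 scalerA mulrC -scalerA E2.
by rewrite !scalerA [_ * val q]mulrC subrr.
Qed.
Canonical loc_equiv := EquivRel loc_eq loc_eq_refl loc_eq_sym loc_eq_trans.

Definition localization := {eq_quot loc_equiv}.
HB.instance Definition _ := EqQuotient.on localization.
HB.instance Definition _ := Choice.on localization.

Definition locfrac (p : R) (q : denom) : localization := \pi_localization (p, q).

Lemma locfrac_eq p q p' q' : locfrac p q = locfrac p' q' <-> val q' *: p = val q *: p'.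
Proof.
rewrite /locfrac; split=> [/eqP|E]; last by apply/eqP; rewrite eqmodE; apply/eqP.
by rewrite eqmodE => /eqP.
Qed.

Lemma locfracP (P : localization -> Prop) :
  (forall p q, P (locfrac p q)) -> forall x, P x.
Proof. by move=> Pfrac; elim/quotW => [[p q]]; apply: Pfrac. Qed.

Lemma locfrac_repr (x : localization) : x = locfrac (repr x).1 (repr x).2.
Proof. by rewrite /locfrac -surjective_pairing reprK. Qed.

Definition loc_add (x y : localization) := let x := repr x in let y := repr y in
  locfrac (val y.2 *: x.1 + val x.2 *: y.1) (denomM x.2 y.2).
Definition loc_mul (x y : localization) := let x := repr x in let y := repr y in
  locfrac (x.1 * y.1) (denomM x.2 y.2).
Definition loc_opp (x : localization) := let x := repr x in locfrac (- x.1) x.2.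
Definition represents (c : {fraction D}) (nd : D * denom) :=
  c * tofrac (val nd.2) = tofrac nd.1.
(** An arbitrary choice of numerator and denominator; [loc_scaleE] shows that scaling does not
    depend on it. *)
Definition frac_pair (c : {fraction D}) : D * denom :=
  epsilon (inhabits (0, denom1)) (represents c).
Definition loc_scale (c : {fraction D}) (x : localization) :=
  let x := repr x in locfrac ((frac_pair c).1 *: x.1) (denomM (frac_pair c).2 x.2).

Lemma frac_pairP c : c * tofrac (val (frac_pair c).2) = tofrac (frac_pair c).1.
Proof.
have [n [d [d0 E]]] := tofrac_reprP c.
by apply: (@epsilon_spec _ _ (represents c)); exists (n, denomX d0).
Qed.

(** Expresses independence of the representatives picked by [repr]: their cross-multiplication
    relations, multiplied by the other denominators, give the one required for the sum. *)
Lemma loc_addE p q p' q' :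
  loc_add (locfrac p q) (locfrac p' q') =
  locfrac (val q' *: p + val q *: p') (denomM q q').
Proof.
rewrite /loc_add; set x := locfrac p q; set y := locfrac p' q'.
have /locfrac_eq := locfrac_repr x; have /locfrac_eq := locfrac_repr y.
case: (repr x) (repr y) => [a r] [b s] /= E1 E2; apply/locfrac_eq => /=.
rewrite !scalerDr !scalerA; congr (_ + _).
  have -> : val q * val q' * val s = val q' * val s * val q by ring.
  have -> : val r * val s * val q' = val q' * val s * val r by ring.
  by rewrite -[LHS]scalerA -[RHS]scalerA E2.
have -> : val q * val q' * val r = val q * val r * val q' by ring.
have -> : val r * val s * val q = val q * val r * val s by ring.
by rewrite -[LHS]scalerA -[RHS]scalerA E1.
Qed.

Lemma loc_mulE p q p' q' :
  loc_mul (locfrac p q) (locfrac p' q') = locfrac (p * p') (denomM q q').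
Proof.
rewrite /loc_mul; set x := locfrac p q; set y := locfrac p' q'.
have /locfrac_eq := locfrac_repr x; have /locfrac_eq := locfrac_repr y.
case: (repr x) (repr y) => [a r] [b s] /= E1 E2; apply/locfrac_eq => /=.
have MZ c d u v : (c * d) *: (u * v) = (c *: u) * (d *: v) :> R.
  by rewrite -scalerA scalerAr scalerAl.
by rewrite !MZ E1 E2.
Qed.

Lemma loc_oppE p q : loc_opp (locfrac p q) = locfrac (- p) q.
Proof.
rewrite /loc_opp; set x := locfrac p q; have /locfrac_eq := locfrac_repr x.
by case: (repr x) => [a r] /= E; apply/locfrac_eq; rewrite !scalerN E.
Qed.

(** Two fractions for the same [c] have equal cross products in [D], since [tofrac] is injective. *)
Lemma loc_scaleE c (n : D) (d : denom) p q : c * tofrac (val d) = tofrac n ->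
  loc_scale c (locfrac p q) = locfrac (n *: p) (denomM d q).
Proof.
move=> Dc; rewrite /loc_scale; set x := locfrac p q; have /locfrac_eq := locfrac_repr x.
have := frac_pairP c; case: (repr x) (frac_pair c) => [a r] [n' d'] /= Dc' E.
have nd : n * val d' = n' * val d.
  by apply/eqP; rewrite -tofrac_eq !rmorphM /= -Dc -Dc' mulrAC.
apply/locfrac_eq => /=; rewrite !scalerA.
have -> : val d * val q * n' = val q * (n' * val d) by ring.
have -> : val d' * val r * n = n * val d' * val r by ring.
by rewrite -nd -[RHS]scalerA E scalerA mulrC.
Qed.

Fact loc_addA : associative loc_add.
Proof.
elim/locfracP=> p q; elim/locfracP=> p1 q1; elim/locfracP=> p2 q2; rewrite !loc_addE.
apply/locfrac_eq => /=; rewrite !mulrA; congr (_ *: _).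
rewrite !scalerDr !scalerA addrA; congr (_ *: _ + _ *: _ + _ *: _).
- by rewrite mulrC.
- by rewrite mulrC.
Qed.
Fact loc_addC : commutative loc_add.
Proof.
elim/locfracP=> p q; elim/locfracP=> p1 q1; rewrite !loc_addE.
by apply/locfrac_eq => /=; rewrite addrC mulrC.
Qed.
Fact loc_add0 : left_id (locfrac 0 denom1) loc_add.
Proof.
elim/locfracP=> p q; rewrite loc_addE; apply/locfrac_eq => /=.
by rewrite scaler0 add0r scale1r mul1r.
Qed.
Fact loc_addN : left_inverse (locfrac 0 denom1) loc_opp loc_add.
Proof.
elim/locfracP=> p q; rewrite loc_oppE loc_addE; apply/locfrac_eq => /=.
by rewrite scalerN addNr !scaler0.
Qed.
HB.instance Definition _ :=
  GRing.isZmodule.Build localization loc_addA loc_addC loc_add0 loc_addN.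

Fact loc_mulA : associative loc_mul.
Proof.
elim/locfracP=> p q; elim/locfracP=> p1 q1; elim/locfracP=> p2 q2; rewrite !loc_mulE.
by apply/locfrac_eq => /=; rewrite !mulrA.
Qed.
Fact loc_mul1 : left_id (locfrac 1 denom1) loc_mul.
Proof.
by elim/locfracP=> p q; rewrite loc_mulE; apply/locfrac_eq => /=; rewrite !mul1r.
Qed.
Fact loc_mulr1 : right_id (locfrac 1 denom1) loc_mul.
Proof.
by elim/locfracP=> p q; rewrite loc_mulE; apply/locfrac_eq => /=; rewrite !mulr1.
Qed.
Fact loc_mulDl : left_distributive loc_mul loc_add.
Proof.
elim/locfracP=> p q; elim/locfracP=> p1 q1; elim/locfracP=> p2 q2.
rewrite !(loc_addE, loc_mulE); apply/locfrac_eq => /=.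
rewrite mulrDl -!scalerAl !scalerDr !scalerA.
by congr (_ *: _ + _ *: _); ring.
Qed.
Fact loc_mulDr : right_distributive loc_mul loc_add.
Proof.
elim/locfracP=> p q; elim/locfracP=> p1 q1; elim/locfracP=> p2 q2.
rewrite !(loc_addE, loc_mulE); apply/locfrac_eq => /=.
rewrite mulrDr -!scalerAr !scalerDr !scalerA.
by congr (_ *: _ + _ *: _); ring.
Qed.
Fact loc_1_neq0 : locfrac 1 denom1 != locfrac 0 denom1.
Proof.
by apply/eqP => /locfrac_eq /eqP /=; rewrite scaler0 scale1r oner_eq0.
Qed.
HB.instance Definition _ := GRing.Zmodule_isNzRing.Build localization
  loc_mulA loc_mul1 loc_mulr1 loc_mulDl loc_mulDr loc_1_neq0.

Lemma locfracD p q p' q' :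
  locfrac p q + locfrac p' q' = locfrac (val q' *: p + val q *: p') (denomM q q').
Proof. exact: loc_addE. Qed.
Lemma locfracM p q p' q' : locfrac p q * locfrac p' q' = locfrac (p * p') (denomM q q').
Proof. exact: loc_mulE. Qed.

Lemma represented c : exists n (d : denom), c * tofrac (val d) = tofrac n.
Proof. by have [n [d [d0 E]]] := tofrac_reprP c; exists n, (denomX d0). Qed.

Fact loc_scaleA a b x : loc_scale a (loc_scale b x) = loc_scale (a * b) x.
Proof.
elim/locfracP: x => p q; have [na [da Ea]] := represented a.
have [nb [db Eb]] := represented b.
rewrite (loc_scaleE _ _ Eb) (loc_scaleE _ _ Ea).
rewrite (@loc_scaleE _ (na * nb) (denomM da db)) /=; last first.
  by rewrite !rmorphM mulrACA Ea Eb.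
by apply/locfrac_eq; rewrite /= !scalerA; congr (_ *: _); ring.
Qed.
Fact loc_scale1 : left_id 1 loc_scale.
Proof.
elim/locfracP=> p q; rewrite (@loc_scaleE _ 1 denom1) ?mulr1 ?rmorph1 //.
by apply/locfrac_eq; rewrite /= scale1r mul1r.
Qed.
Fact loc_scaleDr : right_distributive loc_scale +%R.
Proof.
move=> a; elim/locfracP=> p q; elim/locfracP=> p1 q1; have [n [d E]] := represented a.
rewrite locfracD !(loc_scaleE _ _ E) locfracD; apply/locfrac_eq => /=.
by rewrite !scalerDr !scalerA; congr (_ *: _ + _ *: _); ring.
Qed.
Fact loc_scaleDl x : {morph loc_scale^~ x : a b / a + b}.
Proof.
elim/locfracP: x => p q a b; have [na [da Ea]] := represented a.
have [nb [db Eb]] := represented b.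
rewrite (@loc_scaleE _ (na * val db + nb * val da) (denomM da db)) /=; last first.
  by rewrite !rmorphD !rmorphM mulrDl mulrA Ea [tofrac (val da) * _]mulrC mulrA Eb.
rewrite (loc_scaleE _ _ Eb) (loc_scaleE _ _ Ea) locfracD; apply/locfrac_eq => /=.
by rewrite scalerDl !scalerDr !scalerA; congr (_ *: _ + _ *: _); ring.
Qed.
HB.instance Definition _ := GRing.Zmodule_isLmodule.Build {fraction D} localization
  loc_scaleA loc_scale1 loc_scaleDr loc_scaleDl.

Lemma locfracZ c n (d : denom) p q : c * tofrac (val d) = tofrac n ->
  c *: locfrac p q = locfrac (n *: p) (denomM d q).
Proof. exact: loc_scaleE. Qed.

Fact loc_scaleAl (c : {fraction D}) (x y : localization) :
  c *: (x * y) = (c *: x) * y.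
Proof.
elim/locfracP: x => p q; elim/locfracP: y => p1 q1; have [n [d E]] := represented c.
rewrite locfracM !(locfracZ _ _ E) locfracM; apply/locfrac_eq => /=.
by rewrite -scalerAl !scalerA; congr (_ *: _); ring.
Qed.
HB.instance Definition _ := GRing.Lmodule_isLalgebra.Build {fraction D} localization
  loc_scaleAl.
Fact loc_scaleAr (c : {fraction D}) (x y : localization) :
  c *: (x * y) = x * (c *: y).
Proof.
elim/locfracP: x => p q; elim/locfracP: y => p1 q1; have [n [d E]] := represented c.
rewrite locfracM !(locfracZ _ _ E) locfracM; apply/locfrac_eq => /=.
by rewrite -scalerAr !scalerA; congr (_ *: _); ring.
Qed.
HB.instance Definition _ := GRing.Lalgebra_isAlgebra.Build {fraction D} localization
  loc_scaleAr.

Definition loc_embed p := locfrac p denom1.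

Fact loc_embed_zmod : zmod_morphism loc_embed.
Proof.
move=> p q; apply: (addIr (loc_embed q)); rewrite subrK [LHS]locfracD.
by apply/locfrac_eq; rewrite /= mul1r !scale1r subrK.
Qed.
HB.instance Definition _ := GRing.isZmodMorphism.Build R localization loc_embed
  loc_embed_zmod.
Fact loc_embed_monoid : monoid_morphism loc_embed.
Proof.
by split=> // p q; rewrite [RHS]locfracM; apply/locfrac_eq => /=; rewrite !mul1r.
Qed.
HB.instance Definition _ := GRing.isMonoidMorphism.Build R localization loc_embed
  loc_embed_monoid.

Lemma loc_embedZ q p : loc_embed (q *: p) = tofrac q *: loc_embed p.
Proof.
rewrite (@locfracZ _ q denom1) ?rmorph1 ?mulr1 //.
by apply/locfrac_eq; rewrite /= mul1r.
Qed.

Lemma loc_embed_inj : injective loc_embed.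
Proof. by move=> p q /locfrac_eq; rewrite !scale1r. Qed.

Lemma loc_denominator x : exists q p, q != 0 /\ tofrac q *: x = loc_embed p.
Proof.
elim/locfracP: x => p q; exists (val q), p; split; first exact: (valP q).
rewrite (@locfracZ _ (val q) denom1) ?rmorph1 ?mulr1 //.
by apply/locfrac_eq; rewrite /= scale1r mul1r.
Qed.

End Localization.

Lemma common_denominator (D : idomainType) n (c : nat -> {fraction D}) :
  exists (q : D) (m : nat -> D), q != 0 /\
    forall i, (i < n)%N -> tofrac q * c i = tofrac (m i).
Proof.
elim: n c => [|n IH] c; first by exists 1, (fun=> 0); split; first exact: oner_neq0.
have [q [m [q0 E]]] := IH c; have [a [d [d0 Ed]]] := tofrac_reprP (c n).
exists (q * d), (fun i => if i == n then q * a else m i * d).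
split=> [|i]; first by rewrite mulf_neq0.
rewrite ltnS leq_eqVlt; case: eqP => [-> _|_ /= lti].
  by rewrite !rmorphM -mulrA [tofrac d * _]mulrC Ed.
by rewrite !rmorphM mulrAC E.
Qed.

(* A[t] with scalars k[t] instead of A; its localization is A (x) k(t). *)
Section PolyAlgebra.
Variables (k : fieldType) (A : algType k).

Definition poly_over : Type := {poly A}.
HB.instance Definition _ := GRing.NzRing.copy poly_over {poly A}.

Definition poly_scale (q : {poly k}) (p : poly_over) : poly_over :=
  map_poly (in_alg A) q * (p : {poly A}).

(** Scalars are central in [A], and so is the variable in [A[t]]; hence [k[t]] acts centrally. *)
Lemma map_in_alg_comm (q : {poly k}) (p : {poly A}) :
  map_poly (in_alg A) q * p = p * map_poly (in_alg A) q.
Proof.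
apply/polyP => i; rewrite coefM coefMr; apply: eq_bigr => j _.
by rewrite coef_map /= mulr_algl mulr_algr.
Qed.

Fact poly_scaleA a b p : poly_scale a (poly_scale b p) = poly_scale (a * b) p.
Proof. by rewrite /poly_scale rmorphM mulrA. Qed.
Fact poly_scale1 : left_id 1 poly_scale.
Proof. by move=> p; rewrite /poly_scale rmorph1 mul1r. Qed.
Fact poly_scaleDr : right_distributive poly_scale +%R.
Proof. by move=> a p q; apply: mulrDr. Qed.
Fact poly_scaleDl p : {morph poly_scale^~ p : a b / a + b}.
Proof. by move=> a b; rewrite /poly_scale rmorphD mulrDl. Qed.
HB.instance Definition _ := GRing.Zmodule_isLmodule.Build {poly k} poly_over
  poly_scaleA poly_scale1 poly_scaleDr poly_scaleDl.
Fact poly_scaleAl (a : {poly k}) (p q : poly_over) : a *: (p * q) = (a *: p) * q.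
Proof. exact: mulrA. Qed.
HB.instance Definition _ := GRing.Lmodule_isLalgebra.Build {poly k} poly_over
  poly_scaleAl.
Fact poly_scaleAr (a : {poly k}) (p q : poly_over) : a *: (p * q) = p * (a *: q).
Proof.
rewrite [LHS](mulrA (_ : {poly A})) map_in_alg_comm.
by rewrite -[LHS](mulrA (_ : {poly A})).
Qed.
HB.instance Definition _ := GRing.Lalgebra_isAlgebra.Build {poly k} poly_over
  poly_scaleAr.

(** The leading coefficient of [q] is a nonzero scalar, hence regular in [A], which makes [q] itself
    regular. *)
Lemma poly_over_torsion_free (q : {poly k}) (p : poly_over) :
  q != 0 -> q *: p = 0 -> p = 0.
Proof.
move=> q0 qp0.
have regq : GRing.lreg (map_poly (in_alg A) q).
  apply: lreg_lead; rewrite lead_coef_map /= => x y.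
  rewrite !mulr_algl; apply: scalerI; by rewrite lead_coef_eq0.
by apply: regq; rewrite mulr0.
Qed.

Lemma coef_poly_scale (q : {poly k}) (a : A) i :
  (q *: (a%:P : poly_over) : {poly A})`_i = q`_i *: a.
Proof. by rewrite coefMC coef_map /= mulr_algl. Qed.

Definition rational_ext := localization poly_over_torsion_free.
Definition rational_iota : {rmorphism k -> {fraction {poly k}}} :=
  (@tofrac {poly k} \o polyC).
Definition rational_embed (a : A) : rational_ext :=
  loc_embed poly_over_torsion_free a%:P.

End PolyAlgebra.

(** * The twisted ideal of a bimodule map *)

Section RationalExt.
Variables (k : fieldType) (A : algType k).
Local Notation L := (rational_ext A).
Local Notation K := {fraction {poly k}}.
Local Notation emb := (loc_embed (@poly_over_torsion_free k A)).
Local Notation phi := (@rational_embed k A).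

Lemma poly_scaleC (c : k) (p : {poly A}) :
  c%:P *: (p : poly_over A) = c%:A%:P * p.
Proof. by rewrite /GRing.scale /= /poly_scale map_polyC. Qed.

Lemma poly_scaleXn n (p : {poly A}) : 'X^n *: (p : poly_over A) = 'X^n * p.
Proof. by rewrite /GRing.scale /= /poly_scale map_polyXn. Qed.

(** Both halves clear denominators: a numerator is spanned by its coefficients with powers of [t] as
    scalars, and a relation over [k[t]] splits into relations over [k], one for each power of
    [t]. *)
Lemma rational_scalar_extension :
  scalar_extension (rational_iota k) (phi : A -> L).
Proof.
split; first split=> [//|x y|x y|c a].
- by rewrite /rational_embed polyCD; apply: (rmorphD emb).
- by rewrite /rational_embed polyCM; apply: (rmorphM emb).
- rewrite /rational_embed /rational_iota /= -loc_embedZ poly_scaleC.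
  by rewrite -polyCM mulr_algl.
split=> [b|s /lin_indepP fs].
  have [q [p [q0 E]]] := loc_denominator b.
  (* The spanning list is the coefficient sequence of the numerator [p]. *)
  exists (p : {poly A}); apply/in_spanP.
  have q0' : tofrac q != 0 by rewrite tofrac_eq0.
  rewrite -[b](scalerK q0') E; apply: lspanZ.
  rewrite -[X in loc_embed _ X](@coefK A p) poly_def (raddf_sum emb).
  apply: lspan_sum => i.
  rewrite -mul_polyC commr_polyXn -poly_scaleXn [X in lspan _ X]loc_embedZ.
  by apply/lspanZ/lspan_mem/(map_f phi)/(mem_nth 0).
apply/lin_indepP => c; rewrite size_map => sum0.
have [q [m [q0 E]]] := common_denominator (size s) c.
have q0' : tofrac q != 0 by rewrite tofrac_eq0.
have m0 : \sum_(i < size s) m i *: ((s`_i)%:P : poly_over A) = 0.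
  apply: (@loc_embed_inj _ _ (@poly_over_torsion_free k A)).
  rewrite (raddf_sum emb) (raddf0 emb) -[RHS](scaler0 _ (tofrac q)) -[in RHS]sum0.
  rewrite scaler_sumr; apply: eq_bigr => i _.
  by rewrite scalerA E // [LHS]loc_embedZ (nth_map 0).
move=> i lti; apply/eqP; rewrite -(mulrI_eq0 _ (mulfI q0')) E // tofrac_eq0.
apply/eqP/polyP => j; rewrite coef0.
apply: (fs (fun i => (m i)`_j)) => //.
rewrite -[RHS](coef0 A j) -m0 (coef_sum _ _ _ j) /=; apply: eq_bigr => i' _.
by rewrite coef_poly_scale.
Qed.

End RationalExt.

Section TwistIdeal.
Variables (k : fieldType) (A : algType k) (I : A -> Prop) (f : A -> A).
Local Notation emb := (loc_embed (@poly_over_torsion_free k A)).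
Hypothesis idI : two_sided_ideal I.
Hypothesis fI : bimod_hom_on I f.

Lemma bimod_hom0 : f 0 = 0.
Proof.
have [I0 _ _ _] := idI; have [_ fl _] := fI.
by rewrite -(mul0r 0) fl ?mul0r.
Qed.

Definition poly_in (p : {poly A}) := forall i, I p`_i.
(* (t - f) p, with f acting on coefficients; meaningful when poly_in p. *)
Definition twist (p : {poly A}) : {poly A} := 'X * p - map_poly f p.

Lemma coef_twist p i :
  (twist p)`_i = (if i is j.+1 then p`_j else 0) - f p`_i.
Proof.
by rewrite coefB coefXM coef_map_id0 ?bimod_hom0 //; case: i.
Qed.

Lemma ideal_sum n (F : 'I_n -> A) : (forall i, I (F i)) -> I (\sum_i F i).
Proof. by have [I0 ID _ _] := idI; move=> IF; apply: big_ind. Qed.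

Lemma bimod_hom_sum n (F : 'I_n -> A) :
  (forall i, I (F i)) -> f (\sum_i F i) = \sum_i f (F i).
Proof.
have [fD _ _] := fI; elim: n F => [|n IH] F IF; first by rewrite !big_ord0 bimod_hom0.
by rewrite !big_ord_recl fD ?IH // => *; apply: ideal_sum.
Qed.

Definition twist_ideal (p : poly_over A) : Prop := exists2 r, poly_in r & p = twist r.

(** Acting on coefficients, [f] is an [A[t]]-bimodule map on [I[t]], and [t] is central; so [twist]
    commutes with multiplication on either side. *)
Lemma twist_idealP :
  [/\ twist_ideal 0,
      (forall p q, twist_ideal p -> twist_ideal q -> twist_ideal (p + q)),
      (forall p q, twist_ideal q -> twist_ideal (p * q)) &
      (forall p q, twist_ideal q -> twist_ideal (q * p))].
Proof.
have [I0 ID Il Ir] := idI; have [fD fl fr] := fI.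
split=> [|_ _ [r Ir' ->] [s Is ->]|p _ [r Ir' ->]|p _ [r Ir' ->]].
- exists 0 => [i|]; first by rewrite coef0.
  by rewrite /twist mulr0 sub0r map_poly0 ?oppr0.
- exists (r + s) => [i|]; first by rewrite coefD; apply: ID.
  rewrite /twist mulrDr addrACA -opprD; congr (_ - _).
  by apply/polyP => i; rewrite coefD !coef_map_id0 ?bimod_hom0 ?coefD ?fD.
- exists ((p : {poly A}) * r) => [i|].
    by rewrite coefM; apply: ideal_sum => j; apply: Il.
  rewrite /twist [LHS](mulrBr (_ : {poly A})); congr (_ - _).
    by rewrite [RHS]mulrA -(commr_polyX (p : {poly A})) -[RHS]mulrA.
  apply/polyP => i; rewrite coef_map_id0 ?bimod_hom0 // !coefM bimod_hom_sum.
    by apply: eq_bigr => j _; rewrite coef_map_id0 ?bimod_hom0 ?fl.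
  by move=> j; apply: Il.
- exists (r * (p : {poly A})) => [i|].
    by rewrite coefM; apply: ideal_sum => j; apply: Ir.
  rewrite /twist [LHS](mulrBl (_ : {poly A})) mulrA; congr (_ - _).
  apply/polyP => i; rewrite coef_map_id0 ?bimod_hom0 // !coefM bimod_hom_sum.
    by apply: eq_bigr => j _; rewrite coef_map_id0 ?bimod_hom0 ?fr.
  by move=> j; apply: Ir.
Qed.

Lemma twist_idealZ q p : twist_ideal p -> twist_ideal (q *: p).
Proof.
move=> Jp; have [_ _ Jl _] := twist_idealP.
by rewrite -[p]mul1r scalerAl; apply: Jl.
Qed.

(** The extension of [(t - f) I[t]] to [A(t)], described by clearing denominators. *)
Definition twist_frac_ideal (b : rational_ext A) : Prop :=
  exists (q : {poly k}) p, [/\ q != 0, twist_ideal p &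
    tofrac q *: b = loc_embed (@poly_over_torsion_free k A) p].

Lemma twist_frac_idealP : two_sided_ideal twist_frac_ideal.
Proof.
have [J0 JD Jl Jr] := twist_idealP.
split=> [|b c [q [p [q0 Jp E]]] [r [s [r0 Js E']]]|c b [q [p [q0 Jp E]]]
  |c b [q [p [q0 Jp E]]]].
- by exists 1, 0; rewrite oner_neq0 scaler0 (raddf0 emb).
- exists (q * r), (r *: p + q *: s); split; first by rewrite mulf_neq0.
    by apply: JD; apply: twist_idealZ.
  rewrite (raddfD emb) [X in _ = X + _]loc_embedZ [X in _ = _ + X]loc_embedZ.
  by rewrite -E -E' !scalerA -!rmorphM scalerDr [r * q]mulrC.
- have [r [s [r0 E']]] := loc_denominator c.
  exists (r * q), (s * p); split; [by rewrite mulf_neq0 | exact: Jl |].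
  have -> : emb (s * p) = emb s * emb p := rmorphM emb s p.
  by rewrite -E -E' rmorphM -scalerA scalerAr scalerAl.
- have [r [s [r0 E']]] := loc_denominator c.
  exists (q * r), (p * s); split; [by rewrite mulf_neq0 | exact: Jr |].
  have -> : emb (p * s) = emb p * emb s := rmorphM emb p s.
  by rewrite -E -E' rmorphM -scalerA scalerAr scalerAl.
Qed.

Lemma twist_frac_ideal_nonzero : nonzero_set I -> nonzero_set twist_frac_ideal.
Proof.
have [I0 _ _ _] := idI; move=> [x [Ix x0]].
exists (emb (twist x%:P)); split.
  exists 1, (twist x%:P); rewrite oner_neq0 rmorph1 scale1r; split=> //.
  by exists x%:P => // i; rewrite coefC; case: eqP.
apply: contraNneq x0 => E.
have /(@loc_embed_inj _ _ (@poly_over_torsion_free k A)) Et :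
    emb (twist x%:P) = emb 0.
  by rewrite E (raddf0 emb).
(* The coefficient of [t] in [t x - f x] is [x] itself. *)
have := coef_twist x%:P 1.
rewrite Et coef0 !coefC /= bimod_hom0 subr0 => <-.
exact: eqxx.
Qed.

End TwistIdeal.

(** * Trivial intersection of the twisted ideal with [A] *)

Section TwistTrivialIntersection.
Variables (k : closedFieldType) (A : algType k) (I : A -> Prop) (f : A -> A).
Hypothesis jiA : just_infinite A.
Hypothesis idI : two_sided_ideal I.
Hypothesis nzI : nonzero_set I.
Hypothesis fI : bimod_hom_on I f.
Hypothesis f_inj : forall (c : k) x, I x -> f x = c *: x -> x = 0.

(* Modulo twist_ideal the variable acts on I as f, so a linear factor X - c of
   q can be traded for replacing a by f a - c a, which is again nonzero. *)
Lemma twist_ideal_const (q : {poly k}) a :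
  q != 0 -> twist_ideal I f (q *: (a%:P : poly_over A)) -> a = 0.
Proof.
have [I0 ID Il Ir] := idI; have [J0 JD Jl Jr] := twist_idealP idI fI.
have f0 := bimod_hom0 idI fI; have ctw := coef_twist idI fI.
have [n] := ubnP (size q); elim: n q a => // n IH q a lt_q_n q0 Jqa.
have [sq1|] := eqVneq (size q) 1%N.
  have [c c0 Dq] := size_poly1P _ (introT eqP sq1).
  have [r Ir' Er] := Jqa.
  (* For nonzero [r], the coefficient of [twist r] at index [size r] is the leading coefficient of
     [r], whereas the constant polynomial [c a] has no coefficient there. *)
  have r0 : r = 0.
    apply/eqP; rewrite -lead_coef_eq0; apply/negPn/negP => lr0.
    have := ctw r (size r).
    rewrite -Er coef_poly_scale Dq coefC [r`_(size r)]nth_default // f0 subr0.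
    move: lr0; rewrite lead_coefE; case: (size r) (size_poly_eq0 r) => [|m _] /=.
      by move/esym/eqP=> ->; rewrite coef0 eqxx.
    by rewrite scale0r => lr0 /esym/eqP; rewrite (negPf lr0).
  have := coef_poly_scale q a 0; rewrite Er r0 ctw coef0 f0 subrr.
  by rewrite Dq coefC /= => /esym/eqP; rewrite scaler_eq0 (negPf c0) => /eqP.
move=> /closed_rootP[c /factor_theorem[q1 Dq]].
have q10 : q1 != 0 by apply: contraNneq q0 => q10; rewrite Dq q10 mul0r.
apply: NNPP => /eqP a0; have [y [Iy y0]] := nzI.
(* By primeness [a] can be replaced by a nonzero multiple [a r y] in [I], on which [f] is
   meaningful. *)
have [r ary0] : exists r, a * r * y <> 0.
  apply: NNPP => nr; have [r||] := @just_infinite_prime _ _ jiA a y.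
  - by apply: NNPP => ?; apply: nr; exists r.
  - exact/eqP.
  - exact/eqP.
set a' := a * r * y in ary0; have Ia' : I a' by apply: Il.
have Jqa' : twist_ideal I f (q *: (a'%:P : poly_over A)).
  have -> : a'%:P = a%:P * (r * y)%:P :> {poly A} by rewrite -polyCM /a' mulrA.
  by rewrite [X in twist_ideal _ _ X](scalerAl q (a%:P : poly_over A)); apply: Jr.
clearbody a'; pose b := f a' - c *: a'.
have b0 : b <> 0 by move=> /subr0_eq; apply: contra_not ary0; apply: f_inj.
apply: b0; apply: (IH q1) => //.
  by move: lt_q_n; rewrite Dq size_mul ?polyXsubC_eq0 // size_XsubC addn2.
(* This is [(t - c) a' = (t - f) a' + (f - c) a']; multiplied by [q1], it puts [q1 b] in the ideal
   with [q1] of smaller degree. *)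
have Db : ('X - c%:P) *: (a'%:P : poly_over A) = (twist f a'%:P : poly_over A) + b%:P.
  have Mf : map_poly f a'%:P = (f a')%:P.
    by apply/polyP => i; rewrite coef_map_id0 // !coefC; case: eqP.
  rewrite scalerBl poly_scaleC [X in X - _](poly_scaleXn 1) /twist Mf.
  by rewrite /b polyCB -(mulr_algl c a') polyCM [RHS]addrA subrK.
have -> : q1 *: (b%:P : poly_over A) =
    q *: (a'%:P : poly_over A) - q1 *: (twist f a'%:P : poly_over A).
  by rewrite Dq -scalerA Db scalerDr [RHS]addrC addKr.
apply: JD => //; rewrite -scalerN -[- _]mulN1r.
apply: twist_idealZ => //; apply: Jl; exists a'%:P => // i.
by rewrite coefC; case: eqP.
Qed.

End TwistTrivialIntersection.

Lemma stably_just_infinite_centrally_closed (k : closedFieldType) (A : algType k) :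
  ~ satisfies_PI A -> stably_just_infinite A -> centrally_closed A.
Proof.
move=> nPI [jiA sji] I f idI nzI fI; have [I0 ID Il Ir] := idI; have [fD fl fr] := fI.
apply: NNPP => nscal; apply: nPI.
(* From [x r f(y) = f(x r y) = f(x) r y = x r (c y)] and primeness, agreement of [f] with [c] at one
   nonzero [x] spreads to all of [I]. *)
have f_inj (c : k) x : I x -> f x = c *: x -> x = 0.
  move=> Ix fx; apply: NNPP => /eqP x0; apply: nscal.
  exists c%:A; split=> [a|y Iy]; first by rewrite mulr_algl mulr_algr.
  rewrite mulr_algl; apply: subr0_eq.
  have [r||//] := @just_infinite_prime _ _ jiA x (f y - c *: y); last first.
    by move/eqP; rewrite (negPf x0).
  by rewrite mulrBr -fl // -mulrA fr // fx -scalerAl -scalerAr mulrA subrr.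
have sext := @rational_scalar_extension k A.
(* Stability is applied to the single extension [k(t)] of [k]. *)
have [_ fcL] := sji _ _ _ _ sext.
have idJ := twist_frac_idealP idI fI.
apply: (satisfies_PI_of_finite_codim sext idJ).
  by apply: fcL => //; apply: twist_frac_ideal_nonzero.
move=> a [q [p [q0 Jp]]]; rewrite /rational_embed -[LHS]loc_embedZ => /loc_embed_inj Ep.
by apply: (@twist_ideal_const _ _ I f jiA idI nzI fI f_inj q) => //; rewrite Ep.
Qed.

Theorem theorem3p4 (k : closedFieldType) (A : algType k) :
  just_infinite A -> ~ satisfies_PI A -> center_is_scalars A ->
  (stably_just_infinite A <-> centrally_closed A).
Proof.
move=> jiA nPI cenA; split; first exact: stably_just_infinite_centrally_closed.
exact: centrally_closed_stably_just_infinite.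
Qed.
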